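(* Let $D_1,D_2\ge2$, let $\varrho$ be a density operator on $\mathbb{C}^{D_1}\otimes\mathbb{C}^{D_2}$, and let $\varrho_1=\mathrm{Tr}_2\,\varrho$, $\varrho_2=\mathrm{Tr}_1\,\varrho$. Then $$T_{\max}(\varrho)\ \ge\ \frac{T_{\max}(\varrho_1)+T_{\max}(\varrho_2)}{2}.$$
   Context: For a density operator $\omega$ on a $d$-dimensional Hilbert space and an orthonormal basis $\{|j\rangle\}_{j=1}^d$, the distillable texture of $\omega$ in that basis is $T(\omega)=1-\langle f_1|\omega|f_1\rangle$ with $|f_1\rangle=\frac{1}{\sqrt d}\sum_{j=1}^d|j\rangle$. $T_{\max}(\omega)$ is the maximum of $T(\omega)$ over all orthonormal bases of the $d$-dimensional space on which $\omega$ acts; equivalently $T_{\max}(\omega)=1-\lambda_{\min}(\omega)$, where $\lambda_{\min}(\omega)$ is the smallest eigenvalue of $\omega$. *)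

(* Defs.v *)
From mathcomp Require Import all_boot all_order all_algebra.
From mathcomp Require Import all_classical all_reals.
From mathcomp Require Import complex mxtens.

Set Implicit Arguments.
Unset Strict Implicit.
Unset Printing Implicit Defensive.

Import Order.TTheory GRing.Theory Num.Theory.
Local Open Scope ring_scope.
Local Open Scope complex_scope.
Local Open Scope classical_set_scope.
Local Open Scope sesquilinear_scope.

(* Kets are column vectors, and the bra of v is v^t*, so the inner product is
   conjugate-linear in its first argument. *)
Definition is_density (R : realType) (d : nat) (w : 'M[R[i]]_d) : Prop :=
  [/\ w \is hermsymmx,
      forall v : 'cV[R[i]]_d, 0 <= (v^t* *m w *m v) 0 0
    & \tr w = 1].

(* d orthonormal vectors in dimension d necessarily form a basis. *)
Definition is_onb (R : realType) (d : nat) (e : 'I_d -> 'cV[R[i]]_d) : Prop :=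
  forall j k : 'I_d, ((e j)^t* *m e k) 0 0 = (j == k)%:R.

Definition uniform_ket (R : realType) (d : nat)
    (e : 'I_d -> 'cV[R[i]]_d) : 'cV[R[i]]_d :=
  (sqrtC d%:R)^-1 *: \sum_(j < d) e j.

(* The expectation value <f_1|w|f_1> is real when w is Hermitian; taking its
   real part only makes the texture an element of R. *)
Definition texture (R : realType) (d : nat) (w : 'M[R[i]]_d)
    (e : 'I_d -> 'cV[R[i]]_d) : R :=
  1 - complex.Re (((uniform_ket e)^t* *m w *m uniform_ket e) 0 0).

(* For d > 0 and w Hermitian, this supremum is attained (the unitary group is
   compact), so it is the maximum over all orthonormal bases. *)
Definition Tmax (R : realType) (d : nat) (w : 'M[R[i]]_d) : R :=
  sup [set texture w e | e in [set e : 'I_d -> 'cV[R[i]]_d | is_onb e]].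

(* An operator on C^m (x) C^n is a matrix of size m * n, the basis vector
   |i> (x) |j> having index mxtens_index (i, j) as for Kronecker products *t.
   ptrace1 traces out the first factor, ptrace2 the second one. *)
Definition ptrace1 (R : realType) (m n : nat) (w : 'M[R[i]]_(m * n)) :
    'M[R[i]]_n :=
  \matrix_(j < n, l < n)
    \sum_(i < m) w (mxtens_index (i, j)) (mxtens_index (i, l)).

Definition ptrace2 (R : realType) (m n : nat) (w : 'M[R[i]]_(m * n)) :
    'M[R[i]]_m :=
  \matrix_(i < m, k < m)
    \sum_(j < n) w (mxtens_index (i, j)) (mxtens_index (k, j)).

(* Main.v *)
Require Import Defs.
From mathcomp Require Import all_boot all_order all_algebra.
From mathcomp Require Import all_classical all_reals.
From mathcomp Require Import complex mxtens.

Set Implicit Arguments.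
Unset Strict Implicit.
Unset Printing Implicit Defensive.

Import Order.TTheory GRing.Theory Num.Theory.
Local Open Scope ring_scope.
Local Open Scope complex_scope.

(** Every unit vector is the uniform ket of some orthonormal basis, since some
unitary carries the uniform ket of the standard basis to it.  For a unit vector
[v] of one factor, [<v|rho_1|v>] is the sum over [j] of the nonnegative numbers
[<v (x) j|rho|v (x) j>], hence at least any single one.  So every texture of a
marginal is bounded by a texture of [rho]: [Tmax rho] dominates both
[Tmax rho_1] and [Tmax rho_2], hence their average. *)

Local Open Scope sesquilinear_scope.

(** Gram-Schmidt applied to the matrix with all rows equal to [r] yields a unitary whose first row
    spans the same line as [r]. *)
Lemma unitarymx_with_row0 (C : numClosedFieldType) n (r : 'rV[C]_n.+1) :
  r *m r^t* = 1%:M ->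
  exists2 B : 'M[C]_n.+1, B \is unitarymx & row 0 B = r.
Proof.
move=> r1; pose A : 'M[C]_n.+1 := \matrix_i r.
pose B := schmidt A.
have Bu : B \is unitarymx by apply: schmidt_unitarymx.
have rA : row 0 A = r by rewrite rowK.
have b1 : row 0 B *m (row 0 B)^t* = 1%:M.
  apply/matrixP => i j; rewrite !ord1 -dotmxE.
  by move/row_unitarymxP: Bu => ->; rewrite !mxE !eqxx.
exists B => //.
have : (r <= row 0 B)%MS.
  have := row_schmidt_sub A 0; rewrite rA => /submx_trans; apply.
  apply/sumsmx_subP => k; rewrite leqn0 => /eqP k0.
  by rewrite genmxE (_ : k = 0) //; apply: val_inj.
move=> /sub_rVP[a ra].
(* Gram-Schmidt also fixes the phase: [a] is nonnegative, and comparing norms gives [a ^+ 2 = 1], so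
   [a = 1]. *)
have := form1_row_schmidt A 0; rewrite rA -/B ra dotmxE -scalemxAl b1.
rewrite !mxE eqxx mulr1 => a0.
move: r1; rewrite ra linearZ /= map_mxZ -scalemxAr -scalemxAl b1 scalerA.
move=> /matrixP/(_ 0 0); rewrite !mxE eqxx mulr1 /= geC0_conj // -expr2.
by move=> /eqP; rewrite pexpr_eq1 // => /eqP ->; rewrite scale1r.
Qed.

Lemma normalized_sum_unit (C : numClosedFieldType) m n
    (e : 'I_m -> 'cV[C]_n) : (0 < m)%N ->
  (forall j k, ((e j)^t* *m e k) 0 0 = (j == k)%:R) ->
  let u := (sqrtC m%:R)^-1 *: \sum_(j < m) e j in u^t* *m u = 1%:M.
Proof.
move=> m0 eonb /=; rewrite -scalemxAr linearZ /= map_mxZ.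
rewrite -scalemxAl scalerA.
have -> : (\sum_j e j)^t* *m (\sum_j e j) = m%:R%:M.
  rewrite (raddf_sum trmx) (raddf_sum (map_mx _)) mulmx_suml.
  transitivity (\sum_(i < m) (1%:M : 'M[C]_1)).
    apply: eq_bigr => j _; rewrite mulmx_sumr (bigD1 j) //= big1 ?addr0.
      by apply/matrixP => k l; rewrite !ord1 eonb !mxE !eqxx.
    move=> k kj; apply/matrixP => a b; rewrite !ord1 eonb mxE.
    by rewrite eq_sym (negPf kj).
  by rewrite sumr_const card_ord -scaler_nat scale_scalar_mx mulr1.
rewrite fmorphV /= geC0_conj ?sqrtC_ge0 ?ler0n // scale_scalar_mx -invfM -expr2.
by rewrite sqrtCK mulVf // pnatr_eq0 -lt0n.
Qed.

Section Texture.
Variable R : realType.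
Local Notation C := R[i].

Lemma uniform_ket_unit d (e : 'I_d -> 'cV[C]_d) : (0 < d)%N -> is_onb e ->
  (uniform_ket e)^t* *m uniform_ket e = 1%:M.
Proof. exact: normalized_sum_unit. Qed.

Lemma std_onb d : is_onb (fun j : 'I_d => delta_mx j 0 : 'cV[C]_d).
Proof.
move=> j k; rewrite trmx_delta map_delta_mx mul_delta_mx_cond.
by case: (j == k); rewrite ?mulr1n ?mulr0n mxE ?eqxx.
Qed.

Lemma unit_is_uniform_ket d (v : 'cV[C]_d) : (0 < d)%N -> v^t* *m v = 1%:M ->
  exists2 e : 'I_d -> 'cV[C]_d, is_onb e & uniform_ket e = v.
Proof.
case: d v => // d v _ v1.
pose s : 'cV[C]_d.+1 := uniform_ket (fun j : 'I_d.+1 => delta_mx j 0).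
have tr1 (w : 'cV[C]_d.+1) : w^t* *m w = 1%:M -> w^T *m w^T^t* = 1%:M.
  move=> /(congr1 trmx); rewrite trmx_mul trmx1 => <-.
  by rewrite map_trmx.
have [S Su Ss] :=
  unitarymx_with_row0 (tr1 _ (uniform_ket_unit (ltn0Sn d) (@std_onb d.+1))).
have [V Vu Vv] := unitarymx_with_row0 (tr1 _ v1).
(* The first rows of [S] and [V] are [s^T] and [v^T], so [s^T *m W] is the first row of
   [S *m S^t* *m V = V], namely [v^T]. *)
pose W := S^t* *m V.
have Wu : W \is unitarymx by rewrite mul_unitarymx ?trmxC_unitary.
exists (fun j => (row j W)^T).
  move=> j k; move/row_unitarymxP: Wu => /(_ k j).
  rewrite dotmxE eq_sym => <-; rewrite !mxE.
  by apply: eq_bigr => i _; rewrite !mxE mulrC.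
have -> : uniform_ket (fun j => (row j W)^T) = (s^T *m W)^T.
  rewrite /s /uniform_ket trmx_mul trmxK -scalemxAr mulmx_sumr.
  by congr (_ *: _); apply: eq_bigr => j _; rewrite -colE tr_row.
by rewrite -Ss /W mulmxA -row_mul (unitarymxP _) // -row_mul mul1mx Vv trmxK.
Qed.

Lemma Tmax_has_ubound d (w : 'M[C]_d) : is_density w ->
  has_ubound [set texture w e | e in [set e : 'I_d -> 'cV[C]_d | is_onb e]].
Proof.
move=> [_ wpos _]; exists 1 => _ [e _ <-].
by rewrite /texture lerBlDr lerDl; have := wpos (uniform_ket e); rewrite lecE => /andP[].
Qed.

(** Common form of both marginals: a partial trace is a sum of principal submatrices, one for each
    basis vector of the factor traced out. *)
Lemma Tmax_sum_mxsub m n (I : finType) (i0 : I) (f : I -> 'I_m -> 'I_n)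
    (rho : 'M[C]_n) (w : 'M[C]_m) :
  (0 < m)%N -> is_density rho -> injective (f i0) ->
  w = \sum_i mxsub (f i) (f i) rho -> Tmax w <= Tmax rho.
Proof.
move=> m0 rhod finj wE.
(* [J i] sends the basis vector of index [a] to that of index [f i a]; since [f i0] is injective,
   [J i0] is an isometry. *)
pose J i : 'M[C]_(n, m) := colsub (f i) 1%:M.
have JE i : mxsub (f i) (f i) rho = (J i)^t* *m rho *m J i.
  rewrite /J trmx_mxsub trmx1 map_mxsub map_mx1 mul_rowsub_mx mul1mx.
  by rewrite mulmx_colsub mulmx1 -mxsub_comp.
apply: ge_sup.
  (* Bounding a supremum by its upper bounds requires a nonempty set. *)
  exists (texture w (fun j => delta_mx j 0)), (fun j => delta_mx j 0) => //.
  exact: std_onb.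
move=> _ [e eonb <-].
set u := uniform_ket e.
have n0 : (0 < n)%N by case: (f i0 (Ordinal m0)) => k; apply: leq_ltn_trans.
have Ju : (J i0 *m u)^t* *m (J i0 *m u) = 1%:M.
  rewrite trmx_mul map_mxM mulmxA -(mulmxA (u^t*)).
  rewrite (_ : _ *m J i0 = 1%:M) ?mulmx1 ?uniform_ket_unit //.
  rewrite /J trmx_mxsub trmx1 map_mxsub map_mx1 mulmx_colsub mulmx1 -mxsub_comp.
  by apply/matrixP => a b; rewrite !mxE /= (inj_eq finj).
have [g gonb gu] := unit_is_uniform_ket n0 Ju.
apply: le_trans (ub_le_sup (Tmax_has_ubound rhod) (imageP _ gonb)).
rewrite /texture gu lerB // -/u.
have [_ rpos _] := rhod.
(* The order on [R[i]] compares real parts at equal imaginary parts, so the bound can be proved in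
   [R[i]]. *)
suff : ((J i0 *m u)^t* *m rho *m (J i0 *m u)) 0 0 <= (u^t* *m w *m u) 0 0.
  by rewrite lecE => /andP[].
rewrite wE mulmx_sumr mulmx_suml summxE.
under eq_bigr => i _ do rewrite JE !mulmxA -map_mxM -trmx_mul -(mulmxA _ (J i)).
by rewrite (bigD1 i0) //= lerDl; apply: sumr_ge0.
Qed.

End Texture.

Theorem mainTheorem8 (R : realType) (D1 D2 : nat)
    (hD1 : (2 <= D1)%N) (hD2 : (2 <= D2)%N)
    (rho : 'M[R[i]]_(D1 * D2)) (hrho : is_density rho) :
  Tmax rho >= (Tmax (ptrace2 rho) + Tmax (ptrace1 rho)) / 2%:R.
Proof.
have D1pos : (0 < D1)%N := ltnW hD1; have D2pos : (0 < D2)%N := ltnW hD2.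
rewrite ler_pdivrMr ?ltr0n // mulr_natr mulr2n lerD //.
(* [f j] embeds the first factor as the vectors tensored with [j]; any fixed [j] would serve as
   [i0]. *)
- apply: (Tmax_sum_mxsub (i0 := Ordinal D2pos)
    (f := fun j i => mxtens_index (i, j))) => //.
    by move=> i k /(can_inj (@mxtens_indexK _ _)) [].
  apply/matrixP => i k; rewrite summxE mxE.
  by apply: eq_bigr => j _; rewrite mxE.
- apply: (Tmax_sum_mxsub (i0 := Ordinal D1pos)
    (f := fun i j => mxtens_index (i, j))) => //.
    by move=> i k /(can_inj (@mxtens_indexK _ _)) [].
  apply/matrixP => j l; rewrite summxE mxE.
  by apply: eq_bigr => i _; rewrite mxE.
Qed.
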